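(* Let $\mathcal{P}\subset[0,1]^{\mathbb{N}}$, each $p\in\mathcal{P}$ being identified with the product measure $\mu(p)=\mathrm{Bernoulli}(p_1)\otimes\mathrm{Bernoulli}(p_2)\otimes\cdots$ on $\{0,1\}^{\mathbb{N}}$. Suppose that 1. $\mathcal{P}$ is decaying, 2. $\mathcal{P}$ is strongly symmetric about $\frac12$, 3. $\mathcal{P}$ is learnable. Then $\mathcal{P}\subseteq\dot{\mathsf{LGC}}$, i.e. $T(p)<\infty$ for every $p\in\mathcal{P}$.
   Context: $\mathbb{N}=\{1,2,3,\dots\}$; $\log$ is the natural logarithm. For $x\in[0,1]$ write $\dot x:=\min\{x,1-x\}$, and for $p\in[0,1]^{\mathbb{N}}$ write $\dot p_j:=\min\{p_j,1-p_j\}$. For $p\in[0,1]^{\mathbb{N}}$ define $$T(p):=\inf_{\sigma}\ \sup_{j\in\mathbb{N}}\frac{\log(j+1)}{\log(1/\dot p_{\sigma(j)})}\in[0,\infty],$$ where the infimum is over all permutations (bijections) $\sigma:\mathbb{N}\to\mathbb{N}$, and the ratio is taken to be $0$ when $\dot p_{\sigma(j)}=0$. Define $\dot{\mathsf{LGC}}:=\{p\in[0,1]^{\mathbb{N}}: T(p)<\infty\}$. Estimators and learnability: an estimator $\tilde p$ is given, for each sample size $n\in\mathbb{N}$, by a (measurable) mapping $\tilde p=\tilde p_n:(\{0,1\}^{\mathbb{N}})^n\to[0,1]^{\mathbb{N}}$. For $p\in[0,1]^{\mathbb{N}}$, let $X^{(1)},\dots,X^{(n)}$ be i.i.d. from $\mu(p)$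 and put $$\tilde\Delta_n(p):=\mathbb{E}\,\|\tilde p_n(X^{(1)},\dots,X^{(n)})-p\|_\infty=\mathbb{E}\sup_{j\in\mathbb{N}}|\tilde p_{n,j}(X^{(1)},\dots,X^{(n)})-p_j|.$$ A family $\mathcal{P}\subset[0,1]^{\mathbb{N}}$ is learnable if there is an estimator $\tilde p$ (not depending on $p$) such that $\tilde\Delta_n(p)\to0$ as $n\to\infty$ for each $p\in\mathcal{P}$. $\mathcal{P}$ is decaying if $\lim_{j\to\infty}\dot p_j=0$ for all $p\in\mathcal{P}$. For $p\in[0,1]^{\mathbb{N}}$ and $b\in\{-1,1\}^{\mathbb{N}}$, the $b$-reflection of $p$ about $\frac12$ is the sequence $p'(p,b)\in[0,1]^{\mathbb{N}}$ with $p'_j=b_j(p_j-\frac12)+\frac12$ for $j\in\mathbb{N}$. $\mathcal{P}$ is strongly symmetric about $\frac12$ if $p'(p,b)\in\mathcal{P}$ for all $p\in\mathcal{P}$ and all $b\in\{-1,1\}^{\mathbb{N}}$. *)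

(* Defs.v *)
From HB Require Import structures.
From mathcomp Require Import all_boot all_order all_algebra.
From mathcomp Require Import all_classical all_reals all_analysis.
From mathcomp Require Import measurable_realfun.
From mathcomp Require Import ring lra.

Set Implicit Arguments.
Unset Strict Implicit.
Unset Printing Implicit Defensive.

Import Order.TTheory GRing.Theory Num.Theory.
Import numFieldNormedType.Exports.

Local Open Scope classical_set_scope.
Local Open Scope ring_scope.

(* Conventions: N = {1, 2, ...} is represented by [nat], the index j : nat
   standing for the (j+1)-st coordinate; a sequence p of [0,1]^N is a function
   nat -> R satisfying [unit_seq p]. *)

Definition unit_seq (R : realType) (p : nat -> R) : Prop :=
  forall j, 0 <= p j <= 1.

Definition dot (R : realType) (x : R) : R := Num.min x (1 - x).

(* The space {0,1}^N, with the sigma-algebra generated by the coordinates. *)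

Definition coord_system : set (set (nat -> bool)) :=
  [set A | exists j (B : set bool), A = [set x | B (x j)]].

Definition coins := g_sigma_algebraType coord_system.

(* mu = Bernoulli(p_1) \otimes Bernoulli(p_2) \otimes ... *)
Definition is_bernoulli_product (R : realType) (p : nat -> R)
    (mu : probability coins R) : Prop :=
  forall n (A : nat -> set bool),
    mu [set x | forall j, (j < n)%N -> A j (x j)] =
    (\prod_(j < n) bernoulli_prob (p j) (A j))%E.

(* nu = mu \otimes ... \otimes mu (n factors) *)
Definition is_power (R : realType) d (T : measurableType d)
    (mu : probability T R) n (nu : probability (n.-tuple T) R) : Prop :=
  forall A : 'I_n -> set T, (forall i, measurable (A i)) ->
    nu [set t | forall i, A i (tnth t i)] = (\prod_(i < n) mu (A i))%E.

(* Existence of the countable product: a uniform point of [0,1[ is mapped to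
   the sequence telling, when [a, a + l[ is repeatedly cut into pieces of
   relative lengths q_j and 1 - q_j, in which piece it lies. *)
Section existence.
Context (R : realType).
Implicit Types (q : nat -> R) (a l x : R).

Fixpoint coin_bit q a l x j : bool :=
  if j is j'.+1 then
    if x < a + l * q 0%N then coin_bit (fun i => q i.+1) a (l * q 0%N) x j'
    else coin_bit (fun i => q i.+1) (a + l * q 0%N) (l * (1 - q 0%N)) x j'
  else x < a + l * q 0%N.

Lemma measurable_coin_bit q a l j :
  measurable_fun [set: R] (fun x => coin_bit q a l x j).
Proof.
elim: j q a l => [|j IH] q a l /=; first exact: measurable_fun_ltr.
apply: measurable_fun_ifT; first exact: measurable_fun_ltr.
- exact: IH.
- exact: IH.
Qed.

Lemma measurable_coin_seq q :
  measurable_fun [set: R] (fun x => coin_bit q 0 1 x : coins).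
Proof.
apply: (measurability _ (erefl : @measurable _ coins = <<s coord_system >>)) => _ [_ [j [B ->]] <-].
exact: (measurable_coin_bit q 0 1 j).
Qed.

Lemma measurable_coin_cyl q a l n (A : nat -> set bool) :
  measurable [set x | forall j, (j < n)%N -> A j (coin_bit q a l x j)].
Proof.
rewrite [X in measurable X](_ : _ =
  \bigcap_(j < n) [set x | A j (coin_bit q a l x j)]); last first.
  by apply/seteqP; split.
apply: bigcap_measurableType => j _.
by rewrite -[X in measurable X]setTI; exact: measurable_coin_bit.
Qed.

Lemma coin_cylE q a l n (A : nat -> set bool) : unit_seq q -> 0 <= l ->
  lebesgue_measure (`[a, a + l[ `&`
    [set x | forall j, (j < n)%N -> A j (coin_bit q a l x j)]) =
  (l%:E * \prod_(j < n) bernoulli_prob (q j) (A j))%E.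
Proof.
elim: n q a l A => [|n IH] q a l A q01 l0.
  rewrite big_ord0 mule1 [X in lebesgue_measure X](_ : _ = `[a, a + l[%classic).
    rewrite lebesgue_measure_itv/= lte_fin ltrDl; move: l0.
    rewrite le_eqVlt => /orP[/eqP<-|l0]; first by rewrite ltxx.
    by rewrite l0 -EFinB addrAC subrr add0r.
  by apply/seteqP; split=> x //= [].
have q0 := q01 0%N; have /andP[q00 q0l] := q0.
have l1 : 0 <= l * q 0%N by exact: mulr_ge0.
have l2 : 0 <= l * (1 - q 0%N) by rewrite mulr_ge0// subr_ge0.
have q01' : unit_seq (fun i => q i.+1) by move=> j.
set A' := fun j => A j.+1.
set E1 := `[a, a + l * q 0%N[ `&` [set x | forall j, (j < n)%N ->
   A' j (coin_bit (fun i => q i.+1) a (l * q 0%N) x j)].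
set E2 := `[a + l * q 0%N, a + l * q 0%N + l * (1 - q 0%N)[ `&`
  [set x | forall j, (j < n)%N ->
   A' j (coin_bit (fun i => q i.+1) (a + l * q 0%N) (l * (1 - q 0%N)) x j)].
have mE1 : measurable E1 by apply: measurableI => //; exact: measurable_coin_cyl.
have mE2 : measurable E2 by apply: measurableI => //; exact: measurable_coin_cyl.
pose F1 := [set x | A 0%N true /\ E1 x].
pose F2 := [set x | A 0%N false /\ E2 x].
have F1E : F1 = if `[< A 0%N true >] then E1 else set0.
  by apply/seteqP; split=> x; case: asboolP => ? // [].
have F2E : F2 = if `[< A 0%N false >] then E2 else set0.
  by apply/seteqP; split=> x; case: asboolP => ? // [].
have -> : `[a, a + l[ `&`
    [set x | forall j, (j < n.+1)%N -> A j (coin_bit q a l x j)] = F1 `|` F2.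
  apply/seteqP; split=> x.
  - move=> [/= xal H]; move: xal; rewrite in_itv/= => /andP[ax xl].
    have H0 := H 0%N erefl; rewrite /= in H0.
    case: (ltP x (a + l * q 0%N)) H0 => xc H0; [left|right]; split=> //; split.
    + by rewrite /= in_itv/= ax xc.
    + by move=> j jn /=; have := H j.+1 jn; rewrite /= xc.
    + by rewrite /= in_itv/= xc /=; lra.
    + by move=> j jn /=; have := H j.+1 jn; rewrite /= ltNge xc.
  - case=> -[A0 [/=]]; rewrite in_itv/= => /andP[ax xl] H.
    + split; first by rewrite /= in_itv/= ax /=; nra.
      by case=> [_|j] /=; rewrite xl //; exact: H.
    + split; first by rewrite /= in_itv/=; apply/andP; split; lra.
      by case=> [_|j] /=; rewrite ltNge ax //; exact: H.
have mF1 : measurable F1 by rewrite F1E; case: ifP.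
have mF2 : measurable F2 by rewrite F2E; case: ifP.
rewrite [LHS]measureU//; last first.
  apply/seteqP; split=> // x [[_ [E1x _]] [_ [E2x _]]].
  move: E1x E2x; rewrite /= !in_itv/= => /andP[_ xl] /andP[].
  by rewrite leNgt xl.
rewrite big_ord_recl /= bernoulli_probE// /bump/=.
under eq_bigr do rewrite add1n.
have := IH (fun i => q i.+1) a _ A' q01' l1.
have := IH (fun i => q i.+1) (a + l * q 0%N) _ A' q01' l2.
rewrite -/E1 -/E2 F1E F2E.
set pr := (\prod_(i < n) _)%E => E2E E1E.
have [r prE] : exists r, pr = r%:E.
  have : pr \is a fin_num.
    rewrite /pr; elim/big_ind: _ => // [x y|j _]; first exact: fin_numM.
    by rewrite fin_num_measure.
  by move=> /fineK <-; exists (fine pr).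
rewrite prE in E1E E2E *.
rewrite !diracE !(fun_if lebesgue_measure) E1E E2E measure0.
have inA b : (b \in A 0%N) = `[< A 0%N b >] by apply/idP/asboolP; rewrite inE.
rewrite !inA.
case: asboolP => _; case: asboolP => _ /=; rewrite -?EFinM -?EFinD -?EFinM -?EFinD -?EFinM;
  congr (_%:E); rewrite /unstable.onem; ring.
Qed.

Let unif : probability (measurableTypeR R) R := uniform_prob (@ltr01 R).

Let unifE (A : set R) : measurable A -> unif A = lebesgue_measure (`[0, 1[ `&` A).
Proof.
move=> mA; rewrite /unif /= /uniform_prob integral_uniform_pdf.
rewrite (eq_integral (cst 1%E)); last first.
  move=> x; rewrite inE/= in_itv/= => -[_ x01].
  by rewrite /uniform_pdf x01 subr0 invr1.
rewrite integral_cst ?mul1e; last exact: measurableI.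
have -> : A `&` `[0, 1] = (`[0, 1[ `&` A) `|` (A `&` [set 1]).
  rewrite setIC -(setUitv1 true) ?bnd_simp// setIUl; congr (_ `|` _); exact: setIC.
rewrite measureU0//; [exact: measurableI|exact: measurableI|].
apply/eqP; rewrite -measure_le0 -(lebesgue_measure_set1 (1 : R)).
by apply: le_measure; rewrite ?inE//; exact: measurableI.
Qed.

Lemma bernoulli_product_exists (p : nat -> R) :
  exists mu, is_bernoulli_product p mu.
Proof.
pose q j := if 0 <= p j <= 1 then p j else 0.
have q01 : unit_seq q by move=> j; rewrite /q; case: ifP => //; rewrite lexx ler01.
have qE j : bernoulli_prob (p j) = bernoulli_prob (q j).
  apply/funext => A; rewrite /q; case: ifPn => // p01.
  rewrite [RHS]bernoulli_probE ?lexx ?ler01// mul0e add0e /unstable.onem subr0 mul1e.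
  by rewrite /bernoulli_prob (negbTE p01).
pose f := fun x : measurableTypeR R => coin_bit q 0 1 x : coins.
pose Hf := isMeasurableFun.Build _ _ _ _ f (measurable_coin_seq q).
pose F : {mfun (measurableTypeR R) >-> coins} := HB.pack f Hf.
exists (distribution unif F) => n A.
have -> : (\prod_(j < n) bernoulli_prob (p j) (A j) =
           1%:E * \prod_(j < n) bernoulli_prob (q j) (A j))%E.
  by rewrite mul1e; apply: eq_bigr => j _; rewrite qE.
rewrite -(coin_cylE 0 n A q01 ler01) add0r.
exact: (unifE (measurable_coin_cyl q 0 1 n A)).
Qed.

Lemma power_exists d (T : measurableType d) (mu : probability T R) n :
  exists nu, is_power mu (n := n) nu.
Proof.
elim: n => [|n [nu nuP]].
  exists (\d_([tuple] : 0.-tuple T)) => A _.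
  by rewrite big_ord0 /= diracE mem_set//= => -[].
pose f := fun x : T * n.-tuple T => [the n.+1.-tuple T of x.1 :: x.2].
have mf : measurable_fun [set: T * n.-tuple T] f.
  exact: measurable_cons measurable_fst measurable_snd.
pose Hf := isMeasurableFun.Build _ _ _ _ f mf.
pose F : {mfun (T * n.-tuple T)%type >-> n.+1.-tuple T} := HB.pack f Hf.
exists (distribution (mu \x nu)%E F) => A mA.
rewrite big_ord_recl -nuP// /distribution /pushforward.
rewrite -product_measure1E//; last first.
  rewrite [X in measurable X](_ : _ =
    \bigcap_(i in [set: 'I_n]) ((fun t => tnth t i) @^-1` A (lift ord0 i))).
    apply: fin_bigcap_measurable => // i _.
    by rewrite -[X in measurable X]setTI; exact: measurable_tnth.
  by apply/seteqP; split=> t /= H i; [move=> _|]; exact: H.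
congr ((_ \x _)%E _); apply/seteqP; split=> -[x t] /=.
- move=> H; split; first by have := H ord0; rewrite tnth0.
  by move=> i; have := H (lift ord0 i); rewrite tnthS.
- move=> [Ax At] i; case: (unliftP ord0 i) => [j|] ->; first by rewrite tnthS.
  by rewrite tnth0.
Qed.

End existence.

(* The two specifications below determine the measures uniquely, since the
   measurable rectangles form a generating pi-system. *)

Definition bernoulli_seq (R : realType) (p : nat -> R) : probability coins R :=
  sval (cid (bernoulli_product_exists p)).

Lemma bernoulli_seqP (R : realType) (p : nat -> R) :
  is_bernoulli_product p (bernoulli_seq p).
Proof. exact: svalP (cid _). Qed.

(* Law of an i.i.d. sample X^(1), ..., X^(n) from mu(p). *)
Definition sample_law (R : realType) (p : nat -> R) n :
    probability (n.-tuple coins) R :=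
  sval (cid (power_exists (bernoulli_seq p) n)).

Lemma sample_lawP (R : realType) (p : nat -> R) n :
  is_power (bernoulli_seq p) (sample_law p n).
Proof. exact: svalP (cid _). Qed.

(* Measurability into [0,1]^N with its product sigma-algebra is measurability
   of every coordinate. *)
Definition is_estimator (R : realType)
    (est : forall n, n.-tuple coins -> nat -> R) : Prop :=
  forall n, (forall x, unit_seq (est n x)) /\
            (forall j, measurable_fun [set: n.-tuple coins] (fun x => est n x j)).

Definition risk (R : realType) (est : forall n, n.-tuple coins -> nat -> R)
    (p : nat -> R) (n : nat) : \bar R :=
  (\int[sample_law p n]_x
     ereal_sup (range (fun j : nat => (`|est n x j - p j|)%R%:E)))%E.

Definition learnable (R : realType) (P : set (nat -> R)) : Prop :=
  exists est : forall n, n.-tuple coins -> nat -> R,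
    is_estimator est /\
    forall p, P p -> risk est p n @[n --> \oo] --> 0%E.

Definition decaying (R : realType) (P : set (nat -> R)) : Prop :=
  forall p, P p -> dot (p j) @[j --> \oo] --> (0 : R).

Definition reflection (R : realType) (p b : nat -> R) : nat -> R :=
  fun j => b j * (p j - 2^-1) + 2^-1.

Definition strongly_symmetric (R : realType) (P : set (nat -> R)) : Prop :=
  forall p b : nat -> R, P p -> (forall j, b j = -1 \/ b j = 1) ->
    P (reflection p b).

(* The index shift turns log (j + 1), j >= 1, into ln (j + 2), j >= 0. *)
Definition T_ratio (R : realType) (x : R) (j : nat) : R :=
  if dot x == 0 then 0 else ln j.+2%:R / ln (1 / dot x).

Definition T_functional (R : realType) (p : nat -> R) : \bar R :=
  ereal_inf [set ereal_sup (range (fun j => (T_ratio (p (s j)) j)%:E))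
            | s in [set s : nat -> nat | bijective s]].

Definition LGC_dot (R : realType) : set (nat -> R) :=
  [set p | unit_seq p /\ (T_functional p < +oo)%E].
Arguments LGC_dot : clear implicits.

(* Main.v *)
(* Reflecting p, we may replace it by q_j = min(p_j, 1 - p_j), and all the
   reflections q^b of q, b in {0,1}^N, lie in P. Draw b uniformly at random.
   By dominated convergence there is an n for which the estimator, fed with n
   samples y of mu(q^b), recovers from y all the b_j with j >= J with
   probability more than 1/2, where J is such that q_j < 1/4 for j >= J.
   Write y = x (+) b with x a sample of mu(q) independent of b. Flipping the
   j-th coordinate of b and of all the x_i leaves y unchanged, and it maps the
   event A_j that the x_i are all 1 at j into the event that they are all 0,
   which has a density at least as large. Hence an error at j is at least as
   likely as A_j, also conditionally on any event invariant under this flip;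
   treating the coordinates one after the other,
     1/2 < P(no error at j >= J) <= P(no A_j occurs, j in s)
         = prod_(j in s) (1 - q_j^n)
   for every finite set s of indices >= J. So sum_(j >= J) q_j^n <= 1, and
   sorting the q_j in decreasing order gives T(p) < oo. *)

Require Import Defs.
From HB Require Import structures.
From mathcomp Require Import all_boot all_order all_algebra.
From mathcomp Require Import all_classical all_reals all_analysis.
From mathcomp Require Import measurable_realfun.
From mathcomp Require Import ring lra zify.

Set Implicit Arguments.
Unset Strict Implicit.
Unset Printing Implicit Defensive.

Import Order.TTheory GRing.Theory Num.Theory.
Import numFieldNormedType.Exports.

Local Open Scope classical_set_scope.
Local Open Scope ring_scope.

(** * Cylinder events: a generating pi-system for samples *)

Definition cylinder n (m : nat) (A : 'I_n -> nat -> set bool) :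
    set (n.-tuple coins) :=
  [set t | forall i j, (j < m)%N -> A i j (tnth t i j)].

Definition cylinders n : set (set (n.-tuple coins)) :=
  [set C | exists m A, C = cylinder m A].
Arguments cylinders : clear implicits.

Lemma measurable_coin (j : nat) :
  measurable_fun [set: coins] (fun x : coins => x j).
Proof.
move=> _ B _; rewrite setTI; apply: sub_sigma_algebra.
by exists j, B.
Qed.

Lemma measurable_fun_coinsP d (T : measurableType d) (f : T -> coins) :
  (forall j, measurable_fun [set: T] (fun x => f x j)) ->
  measurable_fun [set: T] f.
Proof.
move=> mf; apply: (measurability _ (erefl : @measurable _ coins = <<s coord_system >>)).
by move=> _ [_ [j [B ->]] <-]; exact: mf.
Qed.

Lemma measurable_coin_tnth n (i : 'I_n) j :
  measurable_fun [set: n.-tuple coins] (fun t => tnth t i j).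
Proof. exact: measurableT_comp (measurable_coin j) (measurable_tnth i). Qed.

Lemma measurable_cylinder n m (A : 'I_n -> nat -> set bool) :
  measurable (cylinder m A).
Proof.
rewrite (_ : cylinder m A = \bigcap_(i in [set: 'I_n]) \bigcap_(j < m)
    (fun t => tnth t i j) @^-1` (A i j)); last first.
  by apply/seteqP; split => t /= h i; [move=> _ j; exact: h|move=> j; exact: h].
apply: fin_bigcap_measurable => // i _; apply: bigcap_measurableType => j _.
by rewrite -[X in measurable X]setTI; exact: measurable_coin_tnth.
Qed.

Lemma measurable_cylindersE n :
  @measurable _ (n.-tuple coins) = <<s cylinders n >>.
Proof.
apply/seteqP; split; last first.
  apply: smallest_sub; first exact: sigma_algebra_measurable.
  by move=> _ [m [A ->]]; exact: measurable_cylinder.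
move=> B mB.
(* The inclusion amounts to measurability of the identity out of the sigma-algebra generated by the
   cylinders, which can be tested on one coordinate of one sample at a time. *)
suff : measurable_fun [set: g_sigma_algebraType (cylinders n)]
    (id : _ -> n.-tuple coins).
  by move=> /(_ measurableT B mB); rewrite setTI.
apply/measurable_fun_tnthP => i; apply: measurable_fun_coinsP => j _ C _.
rewrite setTI; apply: sub_sigma_algebra.
exists j.+1, (fun i' j' => if (i' == i) && (j' == j) then C else setT).
apply/seteqP; split => t /=.
- by move=> Ct i' j' _; case: ifP => // /andP[/eqP-> /eqP->].
- by move=> /(_ i j (ltnSn j)); rewrite !eqxx.
Qed.

Lemma cylinders_setI n : setI_closed (cylinders n).
Proof.
move=> _ _ [m [A ->]] [m' [A' ->]].
exists (maxn m m'), (fun i j => [set b | ((j < m)%N -> A i j b) /\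
                                         ((j < m')%N -> A' i j b)]).
apply/seteqP; split => t /=.
- by move=> [h h'] i j _; split => jm; [exact: h|exact: h'].
- by move=> h; split => i j jm; apply h => //; rewrite leq_max jm ?orbT.
Qed.

(** Cylinders form a generating pi-system that contains the whole space, so a finite measure is
    determined by its values on them. Identities between sample laws thus reduce to identities
    between finite products of Bernoulli probabilities. *)
Lemma eq_measure_cylinders (R : realType) n
    (m1 m2 : {measure set (n.-tuple coins) -> \bar R}) :
  (m1 setT < +oo)%E ->
  (forall m A, m1 (cylinder m A) = m2 (cylinder m A)) ->
  forall S, measurable S -> m1 S = m2 S.
Proof.
move=> m1oo m12 S mS.
apply: (measure_unique (cylinders n) (fun=> setT)) => //.
- exact: measurable_cylindersE.
- exact: cylinders_setI.
- by move=> _; exists 0%N, (fun _ _ => setT); apply/seteqP; split.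
- by apply/seteqP; split => // t _; exists 0%N.
- by move=> _ [m [A ->]].
Qed.

Lemma sample_law_cylinder (R : realType) (p : nat -> R) n m
    (A : 'I_n -> nat -> set bool) :
  sample_law p n (cylinder m A) =
  (\prod_(i < n) \prod_(j < m) bernoulli_prob (p j) (A i j))%E.
Proof.
pose B i : set coins := [set x | forall j, (j < m)%N -> A i j (x j)].
have mB i : measurable (B i).
  rewrite (_ : B i = \bigcap_(j < m) (fun x : coins => x j) @^-1` (A i j)) //.
  apply: bigcap_measurableType => j _.
  by rewrite -[X in measurable X]setTI; exact: measurable_coin.
rewrite [LHS](sample_lawP p mB).
by apply: eq_bigr => i _; exact: bernoulli_seqP.
Qed.

(** * Flipping coordinates of a sample *)

Definition xorc (b x : coins) : coins := fun j => b j (+) x j.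

Definition flip n (b : coins) (t : n.-tuple coins) : n.-tuple coins :=
  map_tuple (xorc b) t.

Lemma tnth_flip n (b : coins) (t : n.-tuple coins) i j :
  tnth (flip b t) i j = b j (+) tnth t i j.
Proof. by rewrite tnth_map. Qed.

Lemma measurable_fun_addb d (T : measurableType d) (f g : T -> bool) :
  measurable_fun [set: T] f -> measurable_fun [set: T] g ->
  measurable_fun [set: T] (fun x => f x (+) g x).
Proof.
move=> mf mg; rewrite (_ : (fun x => _) = (fun x => if f x then ~~ g x else g x)).
  by apply: measurable_fun_ifT => //; exact: measurable_neg.
by apply/funext => x; case: (f x).
Qed.

Lemma measurable_fun_flip d (T : measurableType d) n (f : T -> coins)
    (g : T -> n.-tuple coins) :
  measurable_fun [set: T] f -> measurable_fun [set: T] g ->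
  measurable_fun [set: T] (fun x => flip (f x) (g x)).
Proof.
move=> mf mg; apply/measurable_fun_tnthP => i; apply: measurable_fun_coinsP => j.
rewrite (_ : (fun x => _) = (fun x => f x j (+) tnth (g x) i j)); last first.
  by apply/funext => x /=; rewrite tnth_flip.
apply: measurable_fun_addb; first exact: (measurableT_comp (measurable_coin j)).
exact: (measurableT_comp (measurable_coin_tnth i j)).
Qed.

(** Parameter of the law of [flip b t] when [t] is a sample with parameter [q]; the value [true] of
    [b j] encodes the sign -1 of a reflection. *)
Definition flip_law (R : realType) (q : nat -> R) (b : coins) : nat -> R :=
  fun j => if b j then 1 - q j else q j.

Lemma bernoulli_prob_flip (R : realType) (q : R) (A : set bool) :
  0 <= q <= 1 ->
  bernoulli_prob (1 - q) A = bernoulli_prob q [set x | A (~~ x)].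
Proof.
move=> q01; rewrite !bernoulli_probE//; last by lra.
rewrite !diracE.
have E x : (x \in [set y | A (~~ y)]) = (~~ x \in A) by apply/idP/idP; rewrite !inE.
by rewrite !E /unstable.onem (_ : 1 - (1 - q) = q) 1?addeC //; ring.
Qed.

(** Flipping pulls cylinders back to cylinders and exchanges the two values of a coin wherever [b]
    is [true], so the two laws agree on cylinders. *)
Lemma sample_law_flip (R : realType) (q : nat -> R) n (b : coins)
    (S : set (n.-tuple coins)) : unit_seq q -> measurable S ->
  sample_law q n (flip b @^-1` S) = sample_law (flip_law q b) n S.
Proof.
move=> q01.
have mf : measurable_fun [set: n.-tuple coins] (@flip n b).
  by apply: measurable_fun_flip => //; exact: measurable_cst.
pose Hf := isMeasurableFun.Build _ _ _ _ (@flip n b) mf.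
pose F : {mfun (n.-tuple coins) >-> (n.-tuple coins)} := HB.pack (@flip n b) Hf.
move=> mS; transitivity (distribution (sample_law q n) F S) => //.
apply: eq_measure_cylinders => //.
  by rewrite (le_lt_trans (probability_le1 _ _)) ?ltry.
move=> m A; rewrite [RHS](sample_law_cylinder (flip_law q b)).
transitivity (sample_law q n (flip b @^-1` cylinder m A)) => //.
rewrite (_ : _ @^-1` _ = cylinder m (fun i j => [set x | A i j (b j (+) x)])).
  rewrite sample_law_cylinder; apply: eq_bigr => i _; apply: eq_bigr => j _.
  rewrite /flip_law; case: (b j); last by [].
  by rewrite bernoulli_prob_flip.
by apply/seteqP; split => t /= h i j jm; have := h i j jm; rewrite tnth_flip.
Qed.

Definition all_at n (k : nat) (c : bool) : set (n.-tuple coins) :=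
  [set t | forall i, tnth t i k = c].

(** Padding with trivial constraints brings a prescribed coordinate within the length of the
    cylinder, so that its Bernoulli factor can be singled out. *)
Lemma cylinder_le n m k (A : 'I_n -> nat -> set bool) :
  cylinder m A = cylinder (maxn m k)
    (fun i j => if (j < m)%N then A i j else setT).
Proof.
apply/seteqP; split => t /= h i j.
- by case: ifP => // jm _; exact: h.
- by move=> jm; have := h i j; rewrite jm leq_max jm; exact.
Qed.

Lemma measurable_all_at n k c : measurable (@all_at n k c).
Proof.
rewrite (_ : all_at _ _ = cylinder k.+1
  (fun _ j => if j == k then [set c] else setT)); first exact: measurable_cylinder.
apply/seteqP; split => t /= h i.
- by move=> j _; case: eqP => // ->; exact: h.
- by have := h i k (ltnSn k); rewrite eqxx.
Qed.

Lemma sample_law_cylinder_all_at (R : realType) (p : nat -> R) n m k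
    (A : 'I_n -> nat -> set bool) c : (k < m)%N ->
  sample_law p n (cylinder m A `&` all_at k c) =
  (\prod_(i < n) (\prod_(j < m | j != k :> nat) bernoulli_prob (p j) (A i j) *
     bernoulli_prob (p k) (A i k `&` [set c])))%E.
Proof.
move=> km; rewrite (_ : _ `&` _ = cylinder m
    (fun i j => if j == k then A i k `&` [set c] else A i j)).
  rewrite sample_law_cylinder; apply: eq_bigr => i _.
  rewrite (bigD1 (Ordinal km)) //= eqxx muleC; congr (_ * _)%E.
  by apply: eq_bigr => j; rewrite -val_eqE /= => /negbTE ->.
apply/seteqP; split => t /=.
- by move=> [h h'] i j jm; case: eqP => [->|_]; [split=> /=; [exact: h|exact: h']|exact: h].
- move=> h; split.
  + by move=> i j jm; have := h i j jm; case: eqP => // -> [].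
  + by move=> i; have := h i k km; rewrite eqxx => -[].
Qed.

Definition single (k : nat) : coins := fun j => j == k.

(** A change of density: where all samples vanish at [k], flipping coordinate [k] multiplies the
    density by (q_k / (1 - q_k))^n. The cross-multiplied form avoids the division. *)
Lemma sample_law_flip_point (R : realType) (q : nat -> R) n k
    (S : set (n.-tuple coins)) : unit_seq q -> measurable S ->
  (((1 - q k) ^+ n)%:E * sample_law q n (flip (single k) @^-1` S `&` all_at k true) =
   (q k ^+ n)%:E * sample_law q n (S `&` all_at k false))%E.
Proof.
move=> q01 mS.
have qk := q01 k.
have p0 : 0 <= (1 - q k) ^+ n by apply: exprn_ge0; lra.
have p1 : 0 <= q k ^+ n by apply: exprn_ge0; lra.
have -> : flip (single k) @^-1` S `&` all_at k true =
    flip (single k) @^-1` (S `&` all_at k false).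
  apply/seteqP; split => t /= -[St h]; split => // i; have := h i.
    by rewrite tnth_flip /single eqxx => ->.
  by rewrite tnth_flip /single eqxx; case: (tnth t i k).
rewrite sample_law_flip//; last exact: measurableI mS (measurable_all_at _ _).
(* After the change of variables, both sides are finite measures evaluated at [S]; it suffices to
   compare them on cylinders. *)
pose u := mscale (NngNum p0) (mrestr (sample_law (flip_law q (single k)) n)
  (@measurable_all_at n k false)).
pose v := mscale (NngNum p1) (mrestr (sample_law q n)
  (@measurable_all_at n k false)).
apply: (@eq_measure_cylinders R n u v _ _ S mS).
  rewrite /u /= /mscale /= /mrestr /=.
  by rewrite ltey_eq fin_numM // fin_num_measure //; exact: measurableI (measurable_all_at _ _).
move=> m A; rewrite (cylinder_le _ k.+1) /u /v /= /mscale /= /mrestr /=.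
set m' := maxn _ _; set A' := (X in cylinder m' X).
have km : (k < m')%N by rewrite leq_max leqnn orbT.
rewrite !(sample_law_cylinder_all_at _ _ _ km).
have powE (r : R) : (r ^+ n)%:E = (\prod_(i < n) r%:E)%E.
  by rewrite prodEFin prodr_const card_ord.
rewrite !powE -!big_split /=.
apply: eq_bigr => i _; rewrite muleCA [RHS]muleCA; congr (_ * _)%E.
  by apply: eq_bigr => j jk; rewrite /flip_law /single (negbTE jk).
rewrite /flip_law /single eqxx !bernoulli_probE//; last by lra.
(* Only the outcome [false] survives at coordinate [k]; it has probability 1 - (1 - q_k) = q_k under
   the flipped law and 1 - q_k under the original one. *)
have E0 : (true \in A' i k `&` [set false]) = false by apply/negP; rewrite inE => -[].
by rewrite !diracE !E0 /= !mule0 !add0e /unstable.onem !muleA -!EFinM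
  (_ : (1 - q k) * (1 - (1 - q k)) = q k * (1 - q k)) //; ring.
Qed.

Lemma measurable_forall_in d (T : measurableType d) (A : nat -> set T)
    (s : seq nat) : (forall j, measurable (A j)) ->
  measurable [set z | forall j, j \in s -> A j z].
Proof.
move=> mA; rewrite (_ : mkset _ = \bigcap_(j in [set` s]) A j) //.
exact: bigcap_measurableType.
Qed.

Lemma lee_of_proportional (R : realType) (a b : R) (u v : \bar R) :
  0 < a -> b <= a -> (0 <= v)%E -> (a%:E * u = b%:E * v)%E -> (u <= v)%E.
Proof.
move=> a0 ba v0 E; rewrite -(@lee_pmul2l _ a%:E) ?lte_fin// E.
by apply: lee_wpmul2r => //; rewrite lee_fin.
Qed.

Lemma sample_law_flip_point_le (R : realType) (q : nat -> R) n k
    (S : set (n.-tuple coins)) : unit_seq q -> q k <= 2^-1 -> measurable S ->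
  (sample_law q n (flip (single k) @^-1` S `&` all_at k true) <=
   sample_law q n (S `&` all_at k false))%E.
Proof.
move=> q01 qk mS; have /andP[q0 q1] := q01 k.
apply: (lee_of_proportional _ _ _ (sample_law_flip_point k q01 mS)) => //; first by apply: exprn_gt0; lra.
by apply: lerXn2r; rewrite ?nnegrE; lra.
Qed.

(** * Uniformly random reflections, encoded as samples of size one *)

Definition fair (R : realType) : nat -> R := fun=> 2^-1.

Lemma fair_flip (R : realType) n b (S : set (n.-tuple coins)) : measurable S ->
  sample_law (fair R) n (flip b @^-1` S) = sample_law (fair R) n S.
Proof.
move=> mS; rewrite sample_law_flip //; last by move=> j; rewrite /fair; lra.
congr (sample_law _ n S); apply/funext => j; rewrite /flip_law /fair; case: (b j) => //.
lra.
Qed.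

Lemma integral_fair_flip (R : realType) n b (h : n.-tuple coins -> \bar R) :
  measurable_fun setT h -> (forall t, 0 <= h t)%E ->
  (\int[sample_law (fair R) n]_t h (flip b t) =
   \int[sample_law (fair R) n]_t h t)%E.
Proof.
move=> mh h0.
have mf : measurable_fun [set: n.-tuple coins] (@flip n b).
  by apply: measurable_fun_flip => //; exact: measurable_cst.
pose Hf := isMeasurableFun.Build _ _ _ _ (@flip n b) mf.
pose F : {mfun (n.-tuple coins) >-> (n.-tuple coins)} := HB.pack (@flip n b) Hf.
rewrite -(@ge0_integral_distribution _ _ _ _ _ _ F h) //.
by apply: eq_measure_integral => S mS _; exact: fair_flip.
Qed.

Section joint.
(* For n = 0 the event [all_ones] below is the whole space. *)
Context (R : realType) (q : nat -> R) (n : nat).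
Hypotheses (q01 : unit_seq q) (n0 : (0 < n)%N).

Let beta := sample_law (fair R) 1.
Let nu := sample_law q n.
Let Omega : Type := (1.-tuple coins * n.-tuple coins)%type.

Definition joint_law : set (1.-tuple coins * n.-tuple coins) -> \bar R :=
  (beta \x nu)%E.
HB.instance Definition _ := Measure.on joint_law.

Definition joint_flip k (z : Omega) : Omega :=
  (flip (single k) z.1, flip (single k) z.2).

Lemma measurable_joint_flip k : measurable_fun setT (joint_flip k).
Proof.
apply: measurable_fun_pair.
  by apply: measurable_fun_flip; [exact: measurable_cst|exact: measurable_fst].
by apply: measurable_fun_flip; [exact: measurable_cst|exact: measurable_snd].
Qed.

(** For a fixed reflection, the sections compare by [sample_law_flip_point_le], except that the
    right-hand section is taken at the flipped reflection. Invariance of the uniform law under flips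
    removes this discrepancy after integration. *)
Lemma joint_law_flip_le k (S : set Omega) : q k <= 2^-1 -> measurable S ->
  (joint_law (joint_flip k @^-1` S `&` (snd @^-1` all_at k true)) <=
   joint_law (S `&` (snd @^-1` all_at k false)))%E.
Proof.
move=> qk mS.
have mall c : measurable ((snd @^-1` all_at k c) : set Omega).
  by rewrite -[X in measurable X]setTI; apply: measurable_snd => //; exact: measurable_all_at.
have mth : measurable (joint_flip k @^-1` S `&` (snd @^-1` all_at k true)).
  apply: measurableI => //; rewrite -[X in measurable X]setTI.
  exact: measurable_joint_flip.
have mS' : measurable (S `&` (snd @^-1` all_at k false)) by exact: measurableI.
rewrite /joint_law /= /product_measure1 /=.
rewrite -[leRHS](integral_fair_flip (single k)); last 2 first.
- exact: (measurable_fun_xsection nu mS').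
- by move=> t; exact: measure_ge0.
apply: ge0_le_integral => //.
- exact: (measurable_fun_xsection nu mth).
- apply: (measurableT_comp (measurable_fun_xsection nu mS')).
  by apply: measurable_fun_flip => //; exact: measurable_cst.
move=> c _ /=.
have -> : xsection (joint_flip k @^-1` S `&` snd @^-1` all_at k true) c =
    flip (single k) @^-1` (xsection S (flip (single k) c)) `&` all_at k true.
  by rewrite !xsectionE.
have -> : xsection (S `&` snd @^-1` all_at k false) (flip (single k) c) =
    xsection S (flip (single k) c) `&` all_at k false.
  by rewrite !xsectionE.
by apply: sample_law_flip_point_le => //; exact: measurable_xsection.
Qed.

Context (g : nat -> n.-tuple coins -> bool).
Hypothesis mg : forall j, measurable_fun setT (g j).

(** The data available to the estimator: given the reflection b, its law is that of a sample with
    parameter [flip_law q b]. *)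
Definition observed (z : Omega) : n.-tuple coins := flip (tnth z.1 ord0) z.2.

Definition good_guess j : set Omega :=
  [set z | tnth z.1 ord0 j = g j (observed z)].

Lemma measurable_observed : measurable_fun setT observed.
Proof.
apply: measurable_fun_flip; last exact: measurable_snd.
exact: measurableT_comp (measurable_tnth _) measurable_fst.
Qed.

Lemma measurable_good_guess j : measurable (good_guess j).
Proof.
rewrite (_ : good_guess j = (fun z : Omega =>
    tnth z.1 ord0 j (+) g j (observed z)) @^-1` [set false]).
  rewrite -[X in measurable X]setTI; apply: measurable_fun_addb => //.
    exact: measurableT_comp (measurable_coin_tnth _ _) measurable_fst.
  exact: measurableT_comp (mg j) measurable_observed.
apply/seteqP; split => z /=; rewrite /good_guess /=.
  by move=> ->; rewrite addbb.
by case: (tnth _ _ _); case: (g _ _).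
Qed.

Definition all_ones j : set Omega := snd @^-1` all_at j true.

Lemma measurable_all_ones j : measurable (all_ones j).
Proof.
by rewrite -[X in measurable X]setTI; apply: measurable_snd => //; exact: measurable_all_at.
Qed.

Lemma observed_joint_flip k z : observed (joint_flip k z) = observed z.
Proof.
apply: eq_from_tnth => i; apply/funext => j.
rewrite /observed !tnth_flip /=.
by case: (single k j); case: (tnth _ _ _); case: (tnth _ _ _).
Qed.

Lemma joint_flip_good_guess k j z : j != k ->
  good_guess j (joint_flip k z) <-> good_guess j z.
Proof.
by move=> jk; rewrite /good_guess /= observed_joint_flip tnth_flip /single (negbTE jk).
Qed.

(** The flip changes the bit to be guessed but not the data, hence not the guess. *)
Lemma joint_flip_good_guess_id k z :
  good_guess k (joint_flip k z) <-> ~ good_guess k z.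
Proof.
rewrite /good_guess /= observed_joint_flip tnth_flip /single eqxx.
by case: (tnth _ _ _); case: (g _ _); split.
Qed.

Lemma joint_flip_all_ones k j z : j != k ->
  all_ones j (joint_flip k z) <-> all_ones j z.
Proof.
move=> jk; rewrite /all_ones /all_at /=.
by split => h i; have := h i; rewrite tnth_flip /single (negbTE jk).
Qed.

(** Split the left side according to [all_ones k] and the right side according to [good_guess k].
    The parts with a good guess and without [all_ones k] coincide; a good guess with all ones is
    flipped into an error with all zeros, which lies in the remaining part on the right. *)
Lemma joint_law_good_guess1 k (F : set Omega) :
  q k <= 2^-1 -> measurable F -> (forall z, F (joint_flip k z) <-> F z) ->
  (joint_law (F `&` good_guess k) <= joint_law (F `&` ~` all_ones k))%E.
Proof.
move=> qk mF Fk.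
have mG := measurable_good_guess k; have mA := measurable_all_ones k.
pose S := F `&` ~` good_guess k.
have mS : measurable S by apply: measurableI => //; exact: measurableC.
have le1 := joint_law_flip_le qk mS.
have E1 : joint_flip k @^-1` S `&` snd @^-1` all_at k true =
    F `&` good_guess k `&` all_ones k.
  apply/seteqP; split => z.
    move=> [[/Fk Fz nG] Az]; split => //; split => //.
    by apply: contrapT => h; apply: nG; exact/joint_flip_good_guess_id.
  move=> [[Fz Gz] Az]; split=> //; split; first exact/Fk.
  by move=> /joint_flip_good_guess_id; exact.
rewrite E1 in le1.
have mN : measurable (F `&` ~` all_ones k).
  by apply: measurableI => //; exact: measurableC.
have mFG : measurable (F `&` good_guess k) by exact: measurableI.
rewrite (measureDI joint_law mFG mA) addeC.
rewrite (measureDI joint_law mN mG).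
apply: leeD; last first.
  by apply: le_measure; rewrite ?inE; [exact: measurableD|exact: measurableI|
    move=> z [[? ?] ?]].
apply: (le_trans le1); apply: le_measure; rewrite ?inE.
- apply: measurableI => //; rewrite -[X in measurable X]setTI.
  by apply: measurable_snd => //; exact: measurable_all_at.
- exact: measurableD.
(* All zeros excludes all ones because there is at least one sample. *)
- move=> z [[Fz Gz] Bz]; split => //; split => // Az.
  by have := Az (Ordinal n0); rewrite (Bz (Ordinal n0)).
Qed.

(** Induction on [s], with [F] general so that it can absorb the constraints already treated: once
    [good_guess k] is exchanged for the absence of [all_ones k], the latter joins [F], being
    invariant under the flips at the remaining indices. *)
Lemma joint_law_good_guess (s : seq nat) (F : set Omega) :
  uniq s -> (forall j, j \in s -> q j <= 2^-1) -> measurable F ->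
  (forall j z, j \in s -> F (joint_flip j z) <-> F z) ->
  (joint_law (F `&` [set z | forall j, j \in s -> good_guess j z]) <=
   joint_law (F `&` [set z | forall j, j \in s -> ~ all_ones j z]))%E.
Proof.
elim: s F => [|k s IH] F /=.
  move=> _ _ _ _; rewrite le_eqVlt; apply/orP; left; apply/eqP.
  by congr (joint_law (_ `&` _)); apply/seteqP; split.
move=> /andP[ks us] qs mF Fs.
have mG : measurable [set z | forall j, j \in s -> good_guess j z].
  by apply: measurable_forall_in => j; exact: measurable_good_guess.
set G := [set z | forall j, j \in s -> good_guess j z] in mG IH *.
have -> : F `&` [set z | forall j, j \in k :: s -> good_guess j z] =
    (F `&` G) `&` good_guess k.
  apply/seteqP; split => z.
    move=> [Fz h]; split; last by apply: h; rewrite mem_head.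
    by split => // j js; apply: h; rewrite in_cons js orbT.
  move=> [[Fz h] hk]; split => // j; rewrite in_cons => /predU1P[->//|]; exact: h.
apply: (le_trans (joint_law_good_guess1 (k := k) _ _ _)).
- by apply: qs; rewrite mem_head.
- exact: measurableI.
- move=> z; split=> -[Fz h].
  + split; first by apply/(Fs k); rewrite ?mem_head.
    move=> j js; apply/(joint_flip_good_guess (k := k)); last exact: h.
    by apply: contraNneq ks => <-.
  + split; first by apply/(Fs k); rewrite ?mem_head.
    move=> j js; apply/(joint_flip_good_guess (k := k)); last exact: h.
    by apply: contraNneq ks => <-.
rewrite setIAC.
have -> : F `&` [set z | forall j, j \in k :: s -> ~ all_ones j z] =
    (F `&` ~` all_ones k) `&` [set z | forall j, j \in s -> ~ all_ones j z].
  apply/seteqP; split => z.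
    move=> [Fz h]; split; last by move=> j js; apply: h; rewrite in_cons js orbT.
    by split => //; apply: h; rewrite mem_head.
  move=> [[Fz hk] h]; split => // j; rewrite in_cons => /predU1P[->//|]; exact: h.
apply: IH => //.
- by move=> j js; apply: qs; rewrite in_cons js orbT.
- by apply: measurableI => //; apply: measurableC; exact: measurable_all_ones.
- move=> j z js; have jk : k != j by apply: contraNneq ks => ->.
  have Fj := Fs j z; rewrite in_cons js orbT in Fj.
  split => -[/= Fz h]; split.
  + exact/Fj.
  + by move=> h'; apply: h; apply/(joint_flip_all_ones _ jk).
  + exact/Fj.
  + by move=> /(joint_flip_all_ones _ jk).
Qed.
End joint.

(** * Independence of the all-ones events *)

Lemma probability_avoid_all (R : realType) d (T : measurableType d)
    (P : probability T R) (A : nat -> set T) (a : nat -> R) :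
  (forall j, measurable (A j)) ->
  (forall t, uniq t ->
    P [set z | forall j, j \in t -> A j z] = (\prod_(j <- t) a j)%:E) ->
  forall s, uniq s ->
    P [set z | forall j, j \in s -> ~ A j z] = (\prod_(j <- s) (1 - a j))%:E.
Proof.
move=> mA Pa s us.
(* Mixed events, avoiding the events of [s] and lying in those of [t], make the induction on [s]
   work: an avoided index [k] is treated by subtracting the part of [X s t] inside [A k], namely
   [X s (k :: t)]. *)
pose X (s t : seq nat) := [set z | forall j, j \in s -> ~ A j z] `&`
              [set z | forall j, j \in t -> A j z].
have mX u v : measurable (X u v).
  apply: measurableI; apply: measurable_forall_in => // j.
  exact: measurableC.
suff PX t : uniq (s ++ t) ->
    P (X s t) = (\prod_(j <- s) (1 - a j) * \prod_(j <- t) a j)%:E.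
  have := PX [::]; rewrite cats0 big_nil mulr1 => /(_ us) <-.
  by congr (P _); apply/seteqP; split => [z h|z []] //; split.
elim: s {us} t => [|k s IH] t /=.
  move=> /Pa; rewrite big_nil mul1r => <-.
  by congr (P _); apply/seteqP; split => [z []|z h].
move=> /andP[kst ust].
have : P (X s t) = (P (X s t `\` A k) + P (X s t `&` A k))%E.
  exact: measureDI.
have -> : X s t `&` A k = X s (k :: t).
  apply/seteqP; split => z.
    move=> [[h h'] hk]; split => // j; rewrite in_cons => /predU1P[->//|]; exact: h'.
  move=> [h h']; split; last by apply: h'; rewrite mem_head.
  by split => // j jt; apply: h'; rewrite in_cons jt orbT.
have -> : X s t `\` A k = X (k :: s) t.
  apply/seteqP; split => z.
    move=> [[h h'] hk]; split => // j; rewrite in_cons => /predU1P[->//|]; exact: h.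
  move=> [h h']; split; last by apply: h; rewrite mem_head.
  by split => // j jt; apply: h; rewrite in_cons jt orbT.
have ukt : uniq (s ++ k :: t).
  by rewrite (uniq_catCA s [:: k] t) /= kst.
rewrite IH // IH // !big_cons.
have : P (X (k :: s) t) \is a fin_num by exact: fin_num_measure.
case: (P (X (k :: s) t)) => // r _; rewrite -EFinD => -[E]; congr (_%:E).
by rewrite mulrBl mul1r mulrBl E; ring.
Qed.

Lemma sample_law_all_ones (R : realType) (q : nat -> R) n (s : seq nat) :
  unit_seq q -> uniq s ->
  sample_law q n [set z | forall j, j \in s -> all_at j true z] =
  (\prod_(j <- s) q j ^+ n)%:E.
Proof.
(* A length beyond every index in [s] turns the event into a cylinder. *)
move=> q01 us; set m := (\max_(j <- s) j).+1.
have sm j : j \in s -> (j < m)%N by move=> js; rewrite ltnS leq_bigmax_seq.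
rewrite (_ : mkset _ = cylinder m
    (fun _ j => if j \in s then [set true] else setT)); last first.
  apply/seteqP; split => t /=.
    by move=> h i j _; case: ifP => // js; exact: h.
  by move=> h j js i; have := h i j (sm j js); rewrite js.
rewrite sample_law_cylinder.
rewrite (eq_bigr (fun=> (\prod_(j <- s) q j)%:E)); last first.
  move=> _ _; rewrite -prodEFin.
  rewrite -(big_mkord xpredT (fun j => bernoulli_prob (q j)
    (if j \in s then [set true] else setT))).
  rewrite (eq_bigr (fun j => if j \in s then (q j)%:E else 1%E)).
    rewrite -big_mkcond -big_filter; apply: perm_big; apply: uniq_perm => //.
      by apply: filter_uniq; exact: iota_uniq.
    move=> j; rewrite mem_filter mem_index_iota /=.
    by case: (boolP (j \in s)) => //= /sm.
  move=> j _; case: ifP => // _; last exact: probability_setT.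
  rewrite bernoulli_probE// !diracE.
  by rewrite mem_set// memNset //= mule1 mule0 adde0.
by rewrite prodEFin prodr_const card_ord -prodrXl.
Qed.

Lemma joint_law_good_guess_prod (R : realType) (q : nat -> R) n
    (g : nat -> n.-tuple coins -> bool) (s : seq nat) :
  unit_seq q -> (0 < n)%N -> (forall j, measurable_fun setT (g j)) ->
  uniq s -> (forall j, j \in s -> q j <= 2^-1) ->
  (joint_law q [set z | forall j, j \in s -> good_guess g j z] <=
   (\prod_(j <- s) (1 - q j ^+ n))%:E)%E.
Proof.
move=> q01 n0 mg us qs.
have := @joint_law_good_guess R q n q01 n0 g mg s setT us qs measurableT.
rewrite !setTI => /(_ (fun _ _ _ => iff_refl _)) /le_trans; apply.
rewrite -(@probability_avoid_all _ _ _ (sample_law q n) (fun j => all_at j true)) //.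
(* The event that no all-ones event occurs does not involve the reflection, which integrates out. *)
- rewrite (_ : mkset _ = setT `*` [set t | forall j, j \in s -> ~ all_at j true t]).
    rewrite /joint_law /= product_measure1E //; last first.
      apply: (@measurable_forall_in _ _ (fun j => ~` all_at j true)) => j.
      by apply: measurableC; exact: measurable_all_at.
    by rewrite [X in (X * _)%E](_ : _ = 1%E) ?mul1e //; exact: probability_setT.
  by apply/seteqP; split => z => [h|[_ h]].
- by move=> j; exact: measurable_all_at.
- by move=> t ut; exact: sample_law_all_ones.
Qed.

(** * From vanishing risk to a bound on power sums *)

Lemma le_risk (R : realType) (est : forall n, n.-tuple coins -> nat -> R)
    (p : nat -> R) n (S : set (n.-tuple coins)) (e : R) :
  is_estimator est -> 0 < e -> measurable S ->
  (forall y, S y -> exists j, e <= `|est n y j - p j|) ->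
  (e%:E * sample_law p n S <= risk est p n)%E.
Proof.
move=> hest e0 mS hS.
pose h (j : nat) (y : n.-tuple coins) : \bar R := (`|est n y j - p j|)%:E.
pose f y := ereal_sup (range (h ^~ y)).
have mf : measurable_fun setT f.
  rewrite (_ : f = fun y => esups (h ^~ y) 0%N).
    apply: measurable_fun_esups => j; apply/measurable_EFinP.
    apply: measurableT_comp => //; apply: measurable_funB => //.
    exact: (hest n).2.
  apply/funext => y; congr ereal_sup.
  by apply/seteqP; split => x [j _ <-]; exists j.
have fE y : `|f y|%E = f y.
  rewrite gee0_abs //; apply: (@le_trans _ _ (h 0%N y)).
    by rewrite lee_fin.
  by apply: ereal_sup_ubound; exists 0%N.
(* Markov's inequality for the supremum of the coordinate errors. *)
have := le_integral_abse (sample_law p n) measurableT mf e0.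
under eq_integral do rewrite fE.
apply: le_trans; apply: lee_wpmul2l; first by rewrite lee_fin ltW.
apply: le_measure; rewrite ?inE //.
  apply: emeasurable_fun_c_infty => //; exact: measurableT_comp.
move=> y /hS[j ej]; split => //=; rewrite fE.
apply: (@le_trans _ _ (h j y)); first by rewrite lee_fin.
by apply: ereal_sup_ubound; exists j.
Qed.

(** Each factor satisfies (1 - a)(1 + a + S) <= 1 + S for a, S >= 0. A lower bound on the product
    thereby gives an upper bound on the sum. *)
Lemma prod_1B_sum_le1 (R : realFieldType) (a : nat -> R) (s : seq nat) :
  (forall j, 0 <= a j <= 1) ->
  \prod_(j <- s) (1 - a j) * (1 + \sum_(j <- s) a j) <= 1.
Proof.
move=> a01; elim: s => [|k s IH]; first by rewrite !big_nil addr0 mulr1.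
have /andP[ak0 ak1] := a01 k.
have S0 : 0 <= \sum_(j <- s) a j by apply: sumr_ge0 => j _; case/andP: (a01 j).
have P0 : 0 <= \prod_(j <- s) (1 - a j).
  by apply: prodr_ge0 => j _; rewrite subr_ge0; case/andP: (a01 j).
rewrite !big_cons; apply: le_trans IH; rewrite -mulrA mulrCA.
by apply: ler_wpM2l => //; nra.
Qed.

Section averaging.
Context (R : realType) (est : forall n, n.-tuple coins -> nat -> R).
Hypothesis hest : is_estimator est.
Context (q : nat -> R) (J : nat).
Hypotheses (q01 : unit_seq q) (qJ : forall j, (J <= j)%N -> q j < 4^-1).

Definition guess n j (y : n.-tuple coins) : bool := 2^-1 < est y j.

Lemma measurable_guess n j : measurable_fun setT (@guess n j).
Proof. by apply: measurable_fun_ltr => //; exact: (hest n).2. Qed.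

Definition wrong n (b : coins) : set (n.-tuple coins) :=
  [set y | exists2 j, (J <= j)%N & b j <> guess j y].

Lemma measurable_wrong n b : measurable (@wrong n b).
Proof.
rewrite (_ : wrong b = \bigcup_(j in [set j | (J <= j)%N])
    ((fun y => b j (+) guess j y) @^-1` [set true])).
  apply: bigcup_measurable => j _; rewrite -[X in measurable X]setTI.
  apply: measurable_fun_addb => //; exact: measurable_guess.
by apply/seteqP; split => y [j Jj] h; exists j => //; move: h => /=;
  case: (b j); case: (guess j y).
Qed.

(** From [J] on, the true parameter is below 1/4 or above 3/4 according to the bit, so thresholding
    the estimate at 1/2 can only fail when the estimate is off by at least 1/4. *)
Lemma wrong_le_risk n b :
  ((4^-1)%:E * sample_law (flip_law q b) n (wrong b) <= risk est (flip_law q b) n)%E.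
Proof.
apply: le_risk => //; first exact: measurable_wrong.
move=> y [j Jj]; rewrite /guess => h; exists j; move: h.
have := qJ Jj; have := q01 j; rewrite /flip_law => /andP[q0 q1] qj.
rewrite ler_normr; case: (b j); case: ltP => // h _; apply/orP.
  by right; lra.
by left; lra.
Qed.

Lemma joint_law_wrongE n :
  joint_law q [set z : 1.-tuple coins * n.-tuple coins |
    exists2 j, (J <= j)%N & ~ good_guess (@guess n) j z] =
  (\int[sample_law (fair R) 1]_c
    sample_law (flip_law q (tnth c ord0)) n (wrong (tnth c ord0)))%E.
Proof.
rewrite /joint_law /product_measure1; apply: eq_integral => c _ /=.
rewrite -sample_law_flip //; last exact: measurable_wrong.
by rewrite xsectionE.
Qed.

Lemma joint_law_wrong_cvg :
  (forall b, risk est (flip_law q b) n @[n --> \oo] --> 0%E) ->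
  joint_law q [set z : 1.-tuple coins * n.-tuple coins |
    exists2 j, (J <= j)%N & ~ good_guess (@guess n) j z] @[n --> \oo] --> 0%E.
Proof.
move=> hrisk; under eq_fun do rewrite joint_law_wrongE.
(* The error probability given the reflection. It tends to 0 for each fixed reflection, being at
   most 4 times the risk, and is dominated by 1. *)
pose F n (c : 1.-tuple coins) : \bar R :=
  sample_law (flip_law q (tnth c ord0)) n (wrong (tnth c ord0)).
have mF n : measurable_fun setT (F n).
  pose S := [set z : 1.-tuple coins * n.-tuple coins |
    exists2 j, (J <= j)%N & ~ good_guess (@guess n) j z].
  have mS : measurable S.
    rewrite (_ : S = \bigcup_(j in [set j | (J <= j)%N]) ~` good_guess (@guess n) j) //.
    apply: bigcup_measurable => j _; apply: measurableC.
    by apply: measurable_good_guess; exact: measurable_guess.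
  rewrite (_ : F n = sample_law q n \o xsection S); first exact: measurable_fun_xsection.
  apply/funext => c; rewrite /F -sample_law_flip //; last exact: measurable_wrong.
  by rewrite /= xsectionE.
have Fcvg c : F ^~ c @ \oo --> 0%E.
  apply: (@squeeze_cvge _ _ _ _ (cst 0%E) _
      (fun n => 4%:E * risk est (flip_law q (tnth c ord0)) n)%E).
  - apply: nearW => n; rewrite /F measure_ge0 /=.
    have := wrong_le_risk n (tnth c ord0).
    rewrite -(@lee_pmul2l _ 4%:E) // muleA -EFinM.
    by rewrite divff // mul1e.
  - exact: cvg_cst.
  - rewrite -[X in _ --> X](mule0 4%:E); exact: cvgeZl.
have Fle1 : {ae sample_law (fair R) 1, forall c n, setT c -> (`|F n c| <= cst 1 c)%E}.
  apply: aeW => c n _; rewrite gee0_abs /F ?measure_ge0//.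
  by rewrite probability_le1//; exact: measurable_wrong.
have [_ _] := @dominated_convergence _ _ _ (sample_law (fair R) 1) setT measurableT
  F (cst 0%E) (cst 1%E) mF (measurable_cst _) (aeW _ (fun c _ => Fcvg c))
  (finite_measure_integrable_cst _ 1 measurableT) Fle1.
by rewrite integral0.
Qed.

Lemma bounded_power_sum :
  (forall b, risk est (flip_law q b) n @[n --> \oo] --> 0%E) ->
  exists n, forall s, uniq s -> (forall j, j \in s -> (J <= j)%N) ->
    \sum_(j <- s) q j ^+ n <= 1.
Proof.
move=> /joint_law_wrong_cvg h.
have : \forall n \near \oo, (joint_law q [set z : 1.-tuple coins * n.-tuple coins |
    exists2 j, (J <= j)%N & ~ good_guess (@guess n) j z] < (2^-1)%:E)%E.
  have h2 : (0%:E < (2^-1 : R)%:E)%E by rewrite lte_fin.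
  exact: (h _ (open_ereal_lt' h2)).
(* The sample size is [N.+1] because the comparison with the all-ones events requires it to be
   positive. *)
move=> [N _ hN]; have {hN} := hN N.+1 (leqnSn N) => /=.
set B := (X in joint_law q X) => hB.
exists N.+1 => s us sJ.
have mgd j : measurable (good_guess (@guess N.+1) j).
  by apply: measurable_good_guess; exact: measurable_guess.
have mB : measurable B.
  rewrite (_ : B = \bigcup_(j in [set j | (J <= j)%N])
      ~` good_guess (@guess N.+1) j) //.
  by apply: bigcup_measurable => j _; exact: measurableC.
have := @joint_law_good_guess_prod R q N.+1 (@guess N.+1) s q01 isT
  (@measurable_guess N.+1) us.
set G := [set z | _] => hG.
have mG : measurable G by exact: measurable_forall_in.
(* Either some guess beyond [J] is wrong or all guesses in [s] are right. *)
have : (joint_law q B + joint_law q G >= 1)%E.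
  have <- : joint_law q [set: 1.-tuple coins * N.+1.-tuple coins] = 1%E.
    rewrite -setXTT /joint_law product_measure1E // -[RHS]mule1.
    by congr (_ * _)%E; exact: probability_setT.
  apply: (@le_trans _ _ (joint_law q (B `|` G))); last exact: measureU2.
  apply: le_measure; rewrite ?inE //.
    exact: measurableU.
  move=> z _; case: (pselect (B z)) => [|nB]; [by left|right => j js].
  by apply: contrapT => nG; apply: nB; exists j => //; exact: sJ.
have {}hG : (joint_law q G <= (\prod_(j <- s) (1 - q j ^+ N.+1))%:E)%E.
  by apply: hG => j /sJ /qJ; lra.
have a01 j : 0 <= q j ^+ N.+1 <= 1.
  have /andP[q0 q1] := q01 j.
  by rewrite exprn_ge0 //= exprn_ile1.
have := prod_1B_sum_le1 s a01.
set Pr := \prod_(_ <- _) _ in hG *; set Sm := \sum_(_ <- _) _ => PS.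
move=> BG; have {BG} : (1 < (2^-1)%:E + Pr%:E)%E.
  apply: le_lt_trans BG _.
  apply: (@le_lt_trans _ _ (joint_law q B + Pr%:E)%E); first exact: leeD2l.
  exact: lte_leD.
rewrite -EFinD lte_fin => hP.
(* The product exceeds 1/2 while its multiple by 1 + [Sm] is at most 1, so 1 + [Sm] < 2. *)
by nra.
Qed.
End averaging.

(** * Ranking along a strict total order with finite initial segments *)

Section rank.
Variable lt : rel nat.
Hypotheses (lt_irr : irreflexive lt) (lt_trans : transitive lt).
Hypothesis lt_total : forall i j, i != j -> lt i j || lt j i.
Hypothesis lt_fin : forall j, exists B, forall i, lt i j -> (i < B)%N.

(** The rank of [j] is its number of predecessors. The formula allows any bound [B] on the
    predecessors, so that ranks can be compared over a common range. *)
Lemma exists_rank_bijection :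
  exists tau : nat -> nat, bijective tau /\
    forall j B, (forall i, lt i j -> (i < B)%N) -> tau j = count (lt^~ j) (iota 0 B).
Proof.
have [bd hbd] := choice lt_fin.
pose tau j := count (lt^~ j) (iota 0 (bd j)).
have tauE j B : (forall i, lt i j -> (i < B)%N) -> tau j = count (lt^~ j) (iota 0 B).
  move=> hB; rewrite /tau -!size_filter; apply/perm_size/uniq_perm.
  - by rewrite filter_uniq ?iota_uniq.
  - by rewrite filter_uniq ?iota_uniq.
  move=> i; rewrite !mem_filter !mem_iota /= !add0n.
  by case: (boolP (lt i j)) => // ij; rewrite (hB _ ij) (hbd _ _ ij).
have tau_mono i j : lt i j -> (tau i < tau j)%N.
  move=> ij; set B := maxn (bd i) (bd j).
  rewrite (tauE i B); last by move=> l /hbd h; rewrite leq_max h.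
  rewrite (tauE j B); last by move=> l /hbd h; rewrite leq_max h orbT.
  rewrite -!size_filter.
  have iB : i \in [seq l <- iota 0 B | lt l j].
    by rewrite mem_filter ij mem_iota /= add0n leq_max (hbd _ _ ij) orbT.
  have := @uniq_leq_size _ (i :: [seq l <- iota 0 B | lt l i])
    [seq l <- iota 0 B | lt l j].
  apply => /=; first by rewrite filter_uniq ?iota_uniq // mem_filter lt_irr.
  move=> l; rewrite in_cons => /predU1P[->//|].
  by rewrite !mem_filter => /andP[li ->]; rewrite (lt_trans li ij).
have tau_inj : injective tau.
  move=> i j E; apply/eqP; apply: contraT => /lt_total /orP[] /tau_mono;
    by rewrite E ltnn.
have tau_surj m : exists j, tau j = m.
  have [j mj] : exists j, (m < tau j)%N.
    apply: contrapT => /forallNP h.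
    (* Pigeonhole: [m.+2] distinct ranks cannot all be at most [m]. *)
    have := @uniq_leq_size _ (map tau (iota 0 m.+2)) (iota 0 m.+1).
    rewrite size_map !size_iota ltnn => /(_ _ _)/negP; apply => //.
      by rewrite map_inj_uniq ?iota_uniq.
    move=> x /mapP[j _ ->]; rewrite mem_iota /= add0n ltnS leqNgt.
    by apply/negP/h.
  (* The predecessors of [j], [tau j] in number, have distinct ranks below [tau j], so every value
     below [tau j], in particular [m], is attained. *)
  set s := [seq l <- iota 0 (bd j) | lt l j].
  have [| | |_ E] := @uniq_min_size _ (map tau s) (iota 0 (tau j)).
  - by rewrite map_inj_uniq // filter_uniq ?iota_uniq.
  - move=> x /mapP[l]; rewrite mem_filter => /andP[lj _] ->.
    by rewrite mem_iota /= add0n tau_mono.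
  - by rewrite size_map size_iota size_filter.
  have : m \in map tau s by rewrite E mem_iota.
  by move=> /mapP[l _ ->]; exists l.
have [sigma hs] := choice tau_surj.
exists tau; split => //; exists sigma => // j; apply: tau_inj; exact: hs.
Qed.
End rank.

(** * Polynomial growth of the ranks and finiteness of T *)

Lemma count_iota_le (R : realType) (t : R) B :
  0 < t -> (count (fun i => t <= i.+2%:R^-1) (iota 0 B))%:R <= t^-1.
Proof.
move=> t0; have /truncn_itv/andP[K0 K1] : 0 <= t^-1 by rewrite invr_ge0 ltW.
set K := Num.truncn _ in K0 K1.
apply: le_trans K0; rewrite ler_nat -size_filter -[leqRHS](size_iota 0).
apply: uniq_leq_size; first by rewrite filter_uniq ?iota_uniq.
move=> i; rewrite mem_filter mem_iota /= add0n => /andP[ti _].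
have : i.+2%:R < K.+1%:R :> R.
  by apply: le_lt_trans K1; rewrite -[leLHS]invrK lef_pV2 ?posrE ?invr_gt0.
by rewrite ltr_nat mem_iota; lia.
Qed.

(** Each counted index contributes at least t^n to a sum bounded by 1. *)
Lemma count_power_sum_le (R : realType) (q : nat -> R) J n (t : R) B :
  (forall i, 0 <= q i) -> 0 < t ->
  (forall s, uniq s -> (forall j, j \in s -> (J <= j)%N) ->
    \sum_(j <- s) q j ^+ n <= 1) ->
  (count (fun i => (J <= i)%N && (t <= q i)) (iota 0 B))%:R <= t^-1 ^+ n.
Proof.
move=> q0 t0 hs; rewrite -size_filter; set s := seq.filter _ _.
have tn : 0 < t ^+ n by exact: exprn_gt0.
rewrite exprVn -[leRHS]mul1r ler_pdivlMr //.
have us : uniq s by rewrite filter_uniq ?iota_uniq.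
apply: le_trans (hs s us _); last by move=> j; rewrite mem_filter => /andP[/andP[]].
rewrite -sum1_size natr_sum mulr_suml big_seq [leRHS]big_seq.
apply: ler_sum => j; rewrite mem_filter => /andP[/andP[_ tq] _].
by rewrite mul1r; apply: lerXn2r => //; rewrite nnegrE ?q0 // ltW.
Qed.

Lemma leq_count_or3 (T : Type) (a b1 b2 b3 : pred T) (s : seq T) :
  (forall i, a i -> [|| b1 i, b2 i | b3 i]) ->
  (count a s <= count b1 s + count b2 s + count b3 s)%N.
Proof.
move=> h; elim: s => //= x s IH; have := h x.
by case: (a x); case: (b1 x); case: (b2 x); case: (b3 x) => //= [] h'; lia || by have := h' isT.
Qed.

(** Each summand is at most u^(J + n + 3), and 3 <= u^2. *)
Lemma add3_le_expr (R : realType) (u : R) J n : 2 <= u ->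
  J.+2%:R + u ^+ n + u <= u ^+ (J + n + 5).
Proof.
move=> u2; have u1 : 1 <= u by lra.
set M := (J + n + 3)%N.
have le1 : u ^+ n <= u ^+ M by apply: ler_weXn2l => //; lia.
have le2 : u <= u ^+ M by rewrite -[leLHS]expr1; apply: ler_weXn2l => //; lia.
have le3 : J.+2%:R <= u ^+ M.
  apply: (@le_trans _ _ (u ^+ J.+2)); last by apply: ler_weXn2l => //; lia.
  apply: (@le_trans _ _ (2 ^+ J.+2)); last by apply: lerXn2r => //; rewrite nnegrE; lra.
  by rewrite -natrX ler_nat ltnW // ltn_expl.
have M0 : 0 <= u ^+ M by apply: exprn_ge0; lra.
rewrite (_ : (J + n + 5)%N = M.+2); last by rewrite /M; lia.
rewrite (exprS u M.+1) (exprS u M); have h : 2 * u ^+ M <= u * u ^+ M by exact: ler_wpM2r.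
have : 2 * (u * u ^+ M) <= u * (u * u ^+ M) by apply: ler_wpM2r => //; lra.
by lra.
Qed.

Lemma dot_bounds (R : realType) (x : R) : 0 <= x <= 1 -> 0 <= dot x <= 2^-1.
Proof. by rewrite /dot; case: (leP x (1 - x)) => h h01; lra. Qed.

Lemma T_functional_fin (R : realType) (p : nat -> R) J n :
  unit_seq p -> dot (p j) @[j --> \oo] --> (0 : R) ->
  (forall s, uniq s -> (forall j, j \in s -> (J <= j)%N) ->
    \sum_(j <- s) dot (p j) ^+ n <= 1) ->
  (T_functional p < +oo)%E.
Proof.
move=> p01 p0 hs; pose q j := dot (p j).
have q01 j : 0 <= q j <= 2^-1 by exact: dot_bounds.
(* The terms 1/(j+2) make the sorting key positive, so that the indices with
   dot (p j) = 0 also get a finite rank. *)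
pose r j := Num.max (q j) j.+2%:R^-1.
have r0 j : 0 < r j by rewrite /r lt_max invr_gt0 ltr0n orbT.
have r2 j : r j <= 2^-1.
  rewrite /r ge_max; case/andP: (q01 j) => _ -> /=.
  by rewrite lef_pV2 ?posrE // ler_nat.
(* Decreasing order of the keys, with ties broken by the index to make the order total. *)
pose lt i j := (r j < r i) || (r i == r j) && (i < j)%N.
have lt_irr : irreflexive lt by move=> j; rewrite /lt ltxx ltnn andbF.
have lt_tr : transitive lt.
  move=> j i k; rewrite /lt => /orP[ji|/andP[/eqP -> ij]] /orP[kj|/andP[/eqP E jk]].
  - by rewrite (lt_trans kj ji).
  - by rewrite -E ji.
  - by rewrite kj.
  - by rewrite E eqxx (ltn_trans ij jk) orbT.
have lt_tot i j : i != j -> lt i j || lt j i.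
  by rewrite /lt neq_ltn; case: ltgtP => //= _ ->.
have lt_fi j : exists B, forall i, lt i j -> (i < B)%N.
  have : \forall i \near \oo, q i < r j by exact: cvgr_lt p0 _ (r0 j).
  move=> [B1 _ hB1].
  have [B2 hB2] : exists B2 : nat, (r j)^-1 < B2%:R.
    by exists (Num.truncn (r j)^-1).+1; rewrite truncnS_gt.
  exists (maxn B1 B2) => i; apply: contraTltn => Bi; rewrite /lt negb_or.
  have : r i < r j.
    rewrite {1}/r gt_max hB1 /=; last by apply: leq_trans Bi; exact: leq_maxl.
    rewrite -[ltRHS]invrK ltf_pV2 ?posrE ?invr_gt0 //.
    apply: (lt_le_trans hB2); rewrite ler_nat.
    have := leq_trans (leq_maxr B1 B2) Bi; lia.
  by move=> /[dup] h /ltW; rewrite leNgt => ->; rewrite lt_eqF.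
have [tau [[sigma tauK sigmaK] tauE]] := exists_rank_bijection lt_irr lt_tr lt_tot lt_fi.
pose C := (J + n + 5)%N.
(* A predecessor i of j satisfies i < J, or q_i >= r_j, or 1/(i+2) >= r_j. These cases account for
   at most J, r_j^(-n) and 1/r_j indices; the 2 in [J.+2] comes from the shift in T. *)
have tau_le j : (tau j).+2%:R <= (r j)^-1 ^+ C.
  have [B hB] := lt_fi j; rewrite (tauE _ _ hB).
  apply: le_trans (add3_le_expr J n (_ : 2 <= (r j)^-1)); last first.
    by rewrite -[leLHS]invrK lef_pV2 ?posrE ?invr_gt0.
  apply: (@le_trans _ _ (J.+2%:R +
    (count (fun i => (J <= i)%N && (r j <= q i)) (iota 0 B))%:R +
    (count (fun i => r j <= i.+2%:R^-1) (iota 0 B))%:R)); last first.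
    apply: lerD; last exact: count_iota_le.
    by apply: lerD => //; apply: count_power_sum_le => // i; case/andP: (q01 i).
  rewrite -!natrD ler_nat.
  have : (count (fun i => (i < J)%N) (iota 0 B) <= J)%N.
    rewrite -size_filter -[leqRHS](size_iota 0); apply: uniq_leq_size.
      by rewrite filter_uniq ?iota_uniq.
    by move=> i; rewrite mem_filter !mem_iota => /andP[].
  have : (count (lt^~ j) (iota 0 B) <= count (fun i => (i < J)%N) (iota 0 B) +
    count (fun i => (J <= i)%N && (r j <= q i)%R) (iota 0 B) +
    count (fun i => (r j <= i.+2%:R^-1)%R) (iota 0 B))%N.
    apply: leq_count_or3 => i; rewrite /lt.
    case: (ltnP i J) => //= Ji /orP[h|/andP[/eqP h _]].
      by have := ltW h; rewrite {2}/r le_max.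
    by have := lexx (r i); rewrite {1}h {2}/r le_max.
  by lia.
apply: (@le_lt_trans _ _ C%:R%:E); last exact: ltry.
apply: (@le_trans _ _ (ereal_sup (range (fun j => (T_ratio (p (sigma j)) j)%:E)))).
  by apply: ereal_inf_lbound; exists sigma => //; exists tau.
apply: ge_ereal_sup => _ [j _ <-]; rewrite lee_fin /T_ratio.
case: eqP => [//|/eqP qn0].
set k := sigma j; have jE : j = tau k by rewrite /k sigmaK.
have qk0 : 0 < q k by rewrite lt_neqAle eq_sym qn0; case/andP: (q01 k).
have q2 : 2 <= (q k)^-1.
  by rewrite -[leLHS]invrK lef_pV2 ?posrE ?invr_gt0 //; case/andP: (q01 k).
have ln0 : 0 < ln (q k)^-1 by rewrite ln_gt0 //; lra.
(* It remains to bound j + 2 by q_k^(-C), where j is the rank of k; this follows from [tau_le] since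
   r_k >= q_k. *)
rewrite div1r ler_pdivrMr // mulr_natl -lnXn ?invr_gt0 //.
rewrite ler_ln ?posrE ?exprn_gt0 ?invr_gt0 ?ltr0n // jE.
apply: le_trans (tau_le k) _; apply: lerXn2r.
- by rewrite nnegrE invr_ge0 ltW.
- by rewrite nnegrE invr_ge0 ltW.
- by rewrite lef_pV2 ?posrE // /r le_max lexx.
Qed.

(** * Folding p below 1/2 by symmetry, and conclusion *)

Lemma flip_law_dot (R : realType) (P : set (nat -> R)) (p : nat -> R) (c : coins) :
  strongly_symmetric P -> P p -> P (flip_law (fun j => dot (p j)) c).
Proof.
move=> Psym Pp.
(* Two reflections are composed, the one folding p_j to [dot (p j)] and the one prescribed by [c];
   the sign is -1 when exactly one of them acts. *)
pose b j : R := if (p j <= 1 - p j) (+) c j then 1 else -1.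
rewrite (_ : flip_law _ _ = reflection p b).
  by apply: Psym => // j; rewrite /b; case: ifP; [right|left].
apply/funext => j; rewrite /flip_law /reflection /b /dot /Num.min.
by case: (ltgtP (p j) (1 - p j)) => h; case: (c j) => /=; lra.
Qed.

Theorem theorem1 (R : realType) (P : set (nat -> R))
    (P01 : P `<=` [set p | unit_seq p])
    (Pdec : decaying P) (Psym : strongly_symmetric P) (Plearn : learnable P) :
  P `<=` LGC_dot R.
Proof.
move=> p Pp; have p01 := P01 _ Pp; split => //.
have [est [hest hrisk]] := Plearn.
pose q j := dot (p j).
have q01 : unit_seq q by move=> j; have := dot_bounds (p01 j); rewrite -/(q j); lra.
have [J _ qJ] : \forall j \near \oo, q j < 4^-1.
  by apply: cvgr_lt (Pdec _ Pp) _ _; lra.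
have [n hn] := bounded_power_sum hest q01 qJ
  (fun b => hrisk _ (flip_law_dot b Psym Pp)).
exact: T_functional_fin p01 (Pdec _ Pp) hn.
Qed.
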